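(* Let $\mathbb{F}$ be an algebraically closed field, $q\in\mathbb{F}$ with $q\neq 0$, and $f,g\in\mathbb{F}[h]$. Let $\lambda,\lambda'\in\mathsf{S}_f$, $\mu\in\mathsf{T}_{q,g,\lambda}$, $\mu'\in\mathsf{T}_{q,g,\lambda'}$ and $\gamma,\gamma'\in\mathbb{F}^*$, with $|\lambda|,|\lambda'|,|\mu|,|\mu'|\geq 1$. Then there is an isomorphism of $\mathcal{H}_q(f,g)$-modules $$\mathsf{B}_{q,f,g}(\lambda,\mu)/\mathbb{F}[t^{\pm1}](t^{|\lambda||\mu|}-\gamma)\simeq\mathsf{B}_{q,f,g}(\lambda',\mu')/\mathbb{F}[t^{\pm1}](t^{|\lambda'||\mu'|}-\gamma')$$ if and only if $\gamma=\gamma'$ and there exist $0\leq i<|\lambda|$, $0\leq j<|\mu|$ such that $\lambda'(k)=\lambda(k+i)$ and $\mu'(k)=\mu(k+i+j|\lambda|)$ for all $k\in\mathbb{Z}$.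
   Context: $\mathcal{H}_q(f,g)$ is the unital associative $\mathbb{F}$-algebra generated by $x,y,h$ with defining relations $hx=xf(h)$, $yh=f(h)y$, $yx-qxy=g(h)$; modules are left modules. $\mathsf{S}_f$ is the set of functions $\lambda:\mathbb{Z}\to\mathbb{F}$ with $f(\lambda(i))=\lambda(i+1)$ for all $i\in\mathbb{Z}$; for $\lambda\in\mathsf{S}_f$, $|\lambda|\geq 0$ is the nonnegative generator of the subgroup $\{k\in\mathbb{Z}\mid\lambda(i)=\lambda(i+k)\ \forall i\in\mathbb{Z}\}$ of $\mathbb{Z}$. For $\lambda\in\mathsf{S}_f$, $\mathsf{T}_{q,g,\lambda}$ is the set of functions $\mu:\mathbb{Z}\to\mathbb{F}$ with $\mu(i+1)=q\mu(i)+g(\lambda(i))$ for all $i\in\mathbb{Z}$; for $\mu\in\mathsf{T}_{q,g,\lambda}$ the set $\{k\in\mathbb{Z}\mid\mu(k|\lambda|)=\mu(0)\}$ is a subgroup of $\mathbb{Z}$ (as $q\ne0$), and $|\mu|\geq 0$ denotes its nonnegative generator. For $\lambda\in\mathsf{S}_f$, $\mu\in\mathsf{T}_{q,g,\lambda}$, $\mathsf{B}_{q,f,g}(\lambda,\mu)$ is the module with underlying space the Laurent polynomials $\mathbb{F}[t^{\pm1}]$ and action $ht^i=\lambda(i)t^i$, $xt^i=\mu(i+1)t^{i+1}$, $yt^i=t^{i-1}$ ($i\in\mathbb{Z}$). When $|\lambda|,|\mu|\ge1$ and $\gamma\in\mathbb{F}^*$, the subspace $\mathbb{F}[t^{\pm1}](t^{|\lambda||\mu|}-\gamma)$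 (the ideal of $\mathbb{F}[t^{\pm1}]$ generated by $t^{|\lambda||\mu|}-\gamma$) is a submodule. *)

(* Defs.v *)
From HB Require Import structures.
From mathcomp Require Import all_boot all_algebra finmap.
From mathcomp.multinomials Require Import monalg.
From mathcomp Require Import boolp classical_sets.

Set Implicit Arguments.
Unset Strict Implicit.
Unset Printing Implicit Defensive.

Import GRing.Theory.

Local Open Scope ring_scope.
Local Open Scope quotient_scope.

(* [{malg F[K]}] is the free [F]-module on [K], with basis [<< k >>];
   [malg_ext phi] is the linear map sending [<< k >>] to [phi k]. *)
HB.lock Definition malg_ext (F : fieldType) (K : choiceType) (V : lmodType F)
    (phi : K -> V) (p : {malg F[K]}) : V :=
  \sum_(k <- msupp p) p@_k *: phi k.

Section LinearExtension.
Variables (F : fieldType) (K : choiceType).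

Lemma malg_ind (P : {malg F[K]} -> Prop) :
  P 0 -> (forall p r, P p -> P r -> P (p + r)) ->
  (forall c k, P << c *g k >>) -> forall p, P p.
Proof. by move=> P0 PD PU p; rewrite [p]monalgE; apply: big_ind. Qed.

Lemma malgU_scale (c : F) (k : K) : << c *g k >> = c *: << k >>.
Proof. by apply/malgP=> k'; rewrite mcoeffZ !mcoeffU mulrnAr mulr1. Qed.

Variable V : lmodType F.

Local Notation malg_ext := (@malg_ext F K V).

Lemma malg_extEw (phi : K -> V) (d : {fset K}) (p : {malg F[K]}) :
  (msupp p `<=` d)%fset -> malg_ext phi p = \sum_(k <- d) p@_k *: phi k.
Proof.
move=> le; rewrite malg_ext.unlock (big_fset_incl _ le) //= => k _ /mcoeff_outdom ->.
by rewrite scale0r.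
Qed.

Lemma malg_extU (phi : K -> V) c k : malg_ext phi << c *g k >> = c *: phi k.
Proof. by rewrite (malg_extEw phi msuppU_le) big_seq_fset1 mcoeffUU. Qed.

Lemma malg_ext_linear (phi : K -> V) : linear (malg_ext phi).
Proof.
move=> c p r; pose d := (msupp (c *: p + r) `|` (msupp p `|` msupp r))%fset.
rewrite !(malg_extEw phi (d := d)); first last.
- by rewrite /d fsubsetUl.
- by apply/fsubsetP => k kp; rewrite /d !inE kp orbT.
- by apply/fsubsetP => k kp; rewrite /d !inE kp !orbT.
rewrite scaler_sumr -big_split /=; apply: eq_bigr => k _.
by rewrite mcoeffD mcoeffZ scalerDl scalerA.
Qed.

Lemma malg_ext_linearl (c : F) (phi psi chi : K -> V) p :
  (forall k, chi k = c *: phi k + psi k) ->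
  malg_ext chi p = c *: malg_ext phi p + malg_ext psi p.
Proof.
move=> chiE; rewrite malg_ext.unlock scaler_sumr -big_split /=.
by apply: eq_bigr => k _; rewrite chiE scalerDr !scalerA mulrC.
Qed.

HB.instance Definition _ (phi : K -> V) :=
  GRing.isLinear.Build F {malg F[K]} V *:%R (malg_ext phi)
    (malg_ext_linear phi).

End LinearExtension.

(* The monoid algebra F[K] of a monoid (K, op, e): the product extends [op]
   bilinearly. (The ring structure that [monalg] puts on [{malg F[K]}] asks for
   a monoid without nontrivial units, which excludes the group Z.) *)
HB.lock Definition malg_conv (F : fieldType) (K : choiceType) (op : K -> K -> K)
    (a b : {malg F[K]}) : {malg F[K]} :=
  malg_ext (fun u => malg_ext (fun w => << op u w >>) b) a.

Section MonoidAlgebra.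
Variables (F : fieldType) (K : choiceType) (op : K -> K -> K) (e : K).
Hypotheses (opA : associative op) (op1l : left_id e op) (op1r : right_id e op).

Local Notation conv := (@malg_conv F K op).

Fact malg_convDl : left_distributive conv +%R.
Proof. by move=> a b c; rewrite malg_conv.unlock linearD. Qed.

Fact malg_convZl c a b : conv (c *: a) b = c *: conv a b.
Proof. by rewrite malg_conv.unlock linearZ_LR. Qed.

Fact malg_conv_linear a : linear (conv a).
Proof.
move=> c b b'; rewrite malg_conv.unlock.
by apply: malg_ext_linearl => u; rewrite linearP.
Qed.

Fact malg_convDr : right_distributive conv +%R.
Proof. by move=> a b c; have := malg_conv_linear a 1 b c; rewrite !scale1r. Qed.

Fact malg_conv0r a : conv a 0 = 0.
Proof. by apply: (addrI (conv a 0)); rewrite -malg_convDr !addr0. Qed.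

Fact malg_convZr c a b : conv a (c *: b) = c *: conv a b.
Proof. by have := malg_conv_linear a c b 0; rewrite malg_conv0r !addr0. Qed.

Fact malg_conv0l b : conv 0 b = 0.
Proof. by rewrite malg_conv.unlock linear0. Qed.

Fact malg_convUU c d u w :
  conv << c *g u >> << d *g w >> = << c * d *g op u w >>.
Proof.
rewrite malg_conv.unlock !malg_extU scalerA.
by rewrite [RHS]malgU_scale.
Qed.

Fact malg_convA : associative conv.
Proof.
move=> a b c; elim/malg_ind: a => [|a a' IHa IHa'|x u].
- by rewrite !malg_conv0l.
- by rewrite !malg_convDl IHa IHa'.
elim/malg_ind: b => [|b b' IHb IHb'|y w].
- by rewrite malg_conv0r !malg_conv0l malg_conv0r.
- by rewrite malg_convDl !malg_convDr malg_convDl IHb IHb'.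
elim/malg_ind: c => [|c c' IHc IHc'|z v].
- by rewrite !malg_conv0r.
- by rewrite !malg_convDr IHc IHc'.
by rewrite !malg_convUU opA mulrA.
Qed.

Fact malg_conv1l : left_id << e >> conv.
Proof.
elim/malg_ind => [|a a' IHa IHa'|x u]; first exact: malg_conv0r.
  by rewrite malg_convDr IHa IHa'.
by rewrite malg_convUU op1l mul1r.
Qed.

Fact malg_conv1r : right_id << e >> conv.
Proof.
elim/malg_ind => [|a a' IHa IHa'|x u]; first exact: malg_conv0l.
  by rewrite malg_convDl IHa IHa'.
by rewrite malg_convUU op1r mulr1.
Qed.

Fact malg_convC : commutative op -> commutative conv.
Proof.
move=> opC a b; elim/malg_ind: a => [|a a' IHa IHa'|x u].
- by rewrite malg_conv0l malg_conv0r.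
- by rewrite malg_convDl malg_convDr IHa IHa'.
elim/malg_ind: b => [|b b' IHb IHb'|y w].
- by rewrite malg_conv0l malg_conv0r.
- by rewrite malg_convDl malg_convDr IHb IHb'.
by rewrite !malg_convUU opC mulrC.
Qed.

Fact malg_one_neq0 : (<< e >> : {malg F[K]}) != 0.
Proof. by rewrite monalgU_eq0 oner_eq0. Qed.

End MonoidAlgebra.

Section QuotientModule.
Variables (R : pzRingType) (V : lmodType R) (S : submodClosed V).

(* [submodClosed] does not record closure under opposites, which
   [Quotient.quot] asks for. *)
Definition submod_pred : {pred V} := S.
Local Notation P := submod_pred.

Fact quot_mod_zmod_closed : zmod_closed P.
Proof.
split=> [|u v Pu Pv]; first exact: (@rpred0 _ S).
by rewrite -scaleN1r; apply: (@rpredD _ S) => //; apply: (@rpredZ _ _ S).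
Qed.

HB.instance Definition _ := GRing.isZmodClosed.Build V P quot_mod_zmod_closed.

Definition quot_mod := @Quotient.quot V P.

HB.instance Definition _ := Choice.on quot_mod.
HB.instance Definition _ := GRing.Zmodule.on quot_mod.

Definition quot_pi (v : V) : quot_mod := \pi_(@Quotient.quot V P) v.

Lemma quot_piP (u v : V) : quot_pi u = quot_pi v <-> u - v \in S.
Proof.
by rewrite -[_ \in S]/(_ \in P) Quotient.idealrBE; split=> [/eqP|/eqP].
Qed.

Lemma quot_pi_surj (x : quot_mod) : exists v, x = quot_pi v.
Proof. by exists (repr x); rewrite /quot_pi reprK. Qed.

Lemma quot_piD u v : quot_pi (u + v) = quot_pi u + quot_pi v.
Proof. exact: (raddfD (\pi_(@Quotient.quot V P))). Qed.

Definition quot_scale (a : R) (x : quot_mod) : quot_mod :=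
  locked (quot_pi (a *: repr x)).

Lemma quot_scaleE a v : quot_scale a (quot_pi v) = quot_pi (a *: v).
Proof.
rewrite /quot_scale -lock; apply/quot_piP; rewrite -scalerBr rpredZ //.
by apply/quot_piP; rewrite /quot_pi reprK.
Qed.

Fact quot_scaleA a b x : quot_scale a (quot_scale b x) = quot_scale (a * b) x.
Proof. by have [v ->] := quot_pi_surj x; rewrite !quot_scaleE scalerA. Qed.

Fact quot_scale1 : left_id 1 quot_scale.
Proof. by move=> x; have [v ->] := quot_pi_surj x; rewrite quot_scaleE scale1r. Qed.

Fact quot_scaleDr : right_distributive quot_scale +%R.
Proof.
move=> a x y; have [u ->] := quot_pi_surj x; have [v ->] := quot_pi_surj y.
by rewrite -quot_piD !quot_scaleE scalerDr quot_piD.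
Qed.

Fact quot_scaleDl x : {morph quot_scale^~ x : a b / a + b}.
Proof.
by move=> a b; have [v ->] := quot_pi_surj x; rewrite !quot_scaleE scalerDl quot_piD.
Qed.

HB.instance Definition _ := GRing.Zmodule_isLmodule.Build R quot_mod
  quot_scaleA quot_scale1 quot_scaleDr quot_scaleDl.

Fact quot_pi_linear : linear quot_pi.
Proof. by move=> a u v; rewrite quot_piD -quot_scaleE. Qed.

HB.instance Definition _ :=
  GRing.isLinear.Build R V quot_mod *:%R quot_pi quot_pi_linear.

End QuotientModule.

Variant qgen := Gx | Gy | Gh.
HB.instance Definition _ := gen_eqMixin qgen.
HB.instance Definition _ := gen_choiceMixin qgen.

(* The free associative algebra F<x, y, h>, with basis the words in x, y, h. *)
Definition free_xyh (F : fieldType) := {malg F[seq qgen]}.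

HB.instance Definition _ (F : fieldType) :=
  GRing.Lmodule.copy (free_xyh F) {malg F[seq qgen]}.

Section FreeAlgebra.
Variable F : fieldType.

HB.instance Definition _ := GRing.Zmodule_isNzRing.Build (free_xyh F)
  (malg_convA (@catA qgen)) (malg_conv1l (@cat0s qgen))
  (malg_conv1r (@cats0 qgen)) (@malg_convDl F _ cat) (@malg_convDr F _ cat)
  (malg_one_neq0 F [::]).

Fact free_xyh_scaleAl (c : F) (a b : free_xyh F) : c *: (a * b) = c *: a * b.
Proof. by rewrite [RHS]malg_convZl. Qed.

HB.instance Definition _ :=
  GRing.Lmodule_isLalgebra.Build F (free_xyh F) free_xyh_scaleAl.

Fact free_xyh_scaleAr (c : F) (a b : free_xyh F) : c *: (a * b) = a * (c *: b).
Proof. by rewrite [RHS]malg_convZr. Qed.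

HB.instance Definition _ :=
  GRing.Lalgebra_isAlgebra.Build F (free_xyh F) free_xyh_scaleAr.

Lemma free_xyh_ind (P : free_xyh F -> Prop) :
  P 0 -> (forall a b, P a -> P b -> P (a + b)) ->
  (forall c w, P << c *g w >>) -> forall a, P a.
Proof. exact: malg_ind. Qed.

Lemma free_xyhUU (c d : F) (u w : seq qgen) :
  (<< c *g u >> : free_xyh F) * << d *g w >> = << c * d *g u ++ w >>.
Proof. exact: malg_convUU. Qed.

Definition free_gen (i : qgen) : free_xyh F := << [:: i] >>.

End FreeAlgebra.

(* The algebra H_q(f, g): quotient of F<x, y, h> by the two-sided ideal
   generated by the defining relations. *)
Section Algebra.
Variables (F : fieldType) (q : F) (f g : {poly F}).

Local Notation x := (free_gen F Gx).
Local Notation y := (free_gen F Gy).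
Local Notation h := (free_gen F Gh).

Inductive in_qgha_ideal : free_xyh F -> Prop :=
| qgha_rel_hx : in_qgha_ideal (h * x - x * horner_alg h f)
| qgha_rel_yh : in_qgha_ideal (y * h - horner_alg h f * y)
| qgha_rel_yx : in_qgha_ideal (y * x - q *: (x * y) - horner_alg h g)
| qgha_ideal0 : in_qgha_ideal 0
| qgha_idealD a b : in_qgha_ideal a -> in_qgha_ideal b -> in_qgha_ideal (a + b)
| qgha_idealMl a b : in_qgha_ideal b -> in_qgha_ideal (a * b)
| qgha_idealMr a b : in_qgha_ideal a -> in_qgha_ideal (a * b).

Definition qgha_ideal : {pred free_xyh F} := fun a => `[< in_qgha_ideal a >].

Fact qgha_ideal_submod : submod_closed qgha_ideal.
Proof.
split=> [|c a b]; first exact/asboolP/qgha_ideal0.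
move=> /asboolP Ia /asboolP Ib; apply/asboolP/qgha_idealD => //.
by rewrite -[a]mul1r scalerAl; apply: qgha_idealMl.
Qed.

HB.instance Definition _ :=
  GRing.isSubmodClosed.Build F (free_xyh F) qgha_ideal qgha_ideal_submod.

Definition qgha := quot_mod qgha_ideal.
HB.instance Definition _ := GRing.Lmodule.on qgha.

Definition qgha_pi : free_xyh F -> qgha := quot_pi qgha_ideal.

(* Representations of F<x, y, h> given by three operators. *)
Section Action.
Variables (V : lmodType F) (X Y H : V -> V).
Hypotheses (linX : linear X) (linY : linear Y) (linH : linear H).

Definition gen_act (i : qgen) : V -> V :=
  match i with Gx => X | Gy => Y | Gh => H end.

Definition free_act (a : free_xyh F) (v : V) : V :=
  malg_ext (fun w : seq qgen => foldr gen_act v w) a.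

Lemma word_act_linear (w : seq qgen) : linear (fun v => foldr gen_act v w).
Proof.
elim: w => [|i w IHw] c u v //=; rewrite IHw.
by case: i => /=; rewrite ?linX ?linY ?linH.
Qed.

Lemma free_act_linear a : linear (free_act a).
Proof.
by move=> c u v; apply: malg_ext_linearl => w; apply: word_act_linear.
Qed.

Lemma free_actDl a b v : free_act (a + b) v = free_act a v + free_act b v.
Proof. exact: (linearD (malg_ext _)). Qed.

Lemma free_actZl c a v : free_act (c *: a) v = c *: free_act a v.
Proof. exact: (linearZ_LR (malg_ext _)). Qed.

Lemma free_act0l v : free_act 0 v = 0.
Proof. exact: (linear0 (malg_ext _)). Qed.

Lemma free_actBl a b v : free_act (a - b) v = free_act a v - free_act b v.
Proof. exact: (linearB (malg_ext _)). Qed.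

Lemma free_actDr a u v : free_act a (u + v) = free_act a u + free_act a v.
Proof. by have := free_act_linear a 1 u v; rewrite !scale1r. Qed.

Lemma free_act0r a : free_act a 0 = 0.
Proof. by apply: (addrI (free_act a 0)); rewrite -free_actDr !addr0. Qed.

Lemma free_actZr a c v : free_act a (c *: v) = c *: free_act a v.
Proof. by have := free_act_linear a c v 0; rewrite free_act0r !addr0. Qed.

Lemma free_act_word c (w : seq qgen) v :
  free_act << c *g w >> v = c *: foldr gen_act v w.
Proof. exact: malg_extU. Qed.

Lemma free_act1 v : free_act 1 v = v.
Proof.
have -> : (1 : free_xyh F) = << 1 *g [::] >> by [].
by rewrite free_act_word scale1r.
Qed.

Lemma free_act_gen i v : free_act (free_gen F i) v = gen_act i v.
Proof. by rewrite /free_gen free_act_word scale1r. Qed.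

Lemma free_actM a b v : free_act (a * b) v = free_act a (free_act b v).
Proof.
elim/free_xyh_ind: a => [|a a' IHa IHa'|c u].
- by rewrite mul0r !free_act0l.
- by rewrite mulrDl !free_actDl IHa IHa'.
elim/free_xyh_ind: b => [|b b' IHb IHb'|d w].
- by rewrite mulr0 !free_act0l free_act0r.
- by rewrite mulrDr !free_actDl free_actDr IHb IHb'.
rewrite free_xyhUU free_act_word [free_act << d *g w >> v]free_act_word.
by rewrite free_actZr free_act_word foldr_cat scalerA mulrC.
Qed.

Lemma free_act_horner_eigen (p : {poly F}) (c : F) v :
  H v = c *: v -> free_act (horner_alg h p) v = p.[c] *: v.
Proof.
move=> Hv; elim/poly_ind: p => [|p d IHp].
  by rewrite rmorph0 free_act0l horner0 scale0r.
rewrite rmorphD rmorphM /= horner_algX horner_algC free_actDl free_actM.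
rewrite free_act_gen /= Hv free_actZr IHp free_actZl free_act1.
by rewrite hornerMXaddC scalerDl scalerA mulrC.
Qed.

Definition qgha_relations :=
  [/\ forall v, H (X v) = X (free_act (horner_alg h f) v),
      forall v, Y (H v) = free_act (horner_alg h f) (Y v)
    & forall v, Y (X v) - q *: X (Y v) = free_act (horner_alg h g) v].

Hypothesis rels : qgha_relations.

Lemma free_act_ideal a : a \in qgha_ideal -> forall v, free_act a v = 0.
Proof.
have [rhx ryh ryx] := rels.
move=> /asboolP; elim=> {a} [||||a b _ IHa _ IHb|a b _ IHb|a b _ IHa] v.
- rewrite free_actBl (free_actM h) (free_actM x) !(free_act_gen Gh, free_act_gen Gx).
  by rewrite /= rhx subrr.
- rewrite free_actBl (free_actM y) (free_actM _ y) !(free_act_gen Gh, free_act_gen Gy).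
  by rewrite /= ryh subrr.
- rewrite 2!free_actBl free_actZl (free_actM y) (free_actM x).
  by rewrite !(free_act_gen Gx, free_act_gen Gy) /= ryx subrr.
- exact: free_act0l.
- by rewrite free_actDl IHa IHb addr0.
- by rewrite free_actM IHb free_act0r.
- by rewrite free_actM IHa.
Qed.

Definition qgha_act (a : qgha) (v : V) : V := locked (free_act (repr a) v).

Lemma qgha_actE a v : qgha_act (qgha_pi a) v = free_act a v.
Proof.
rewrite /qgha_act -lock; apply/eqP; rewrite -subr_eq0 -free_actBl; apply/eqP/free_act_ideal.
by apply/quot_piP; rewrite /quot_pi reprK.
Qed.

End Action.

(* Nontriviality: the span of t^n (n in nat), with h acting by the orbit of 0
   under f, is a nonzero representation satisfying the relations. *)
Section Nontrivial.

Let lam (n : nat) : F := iter n (fun c => f.[c]) 0.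
Fixpoint qgha_mu0 (n : nat) : F :=
  if n is m.+1 then q * qgha_mu0 m + g.[lam m] else 0.
Local Notation mu := qgha_mu0.

Let V : lmodType F := {malg F[nat]}.
Let X : V -> V := malg_ext (fun n => << mu n.+1 *g n.+1 >>).
Let Y : V -> V := malg_ext (fun n => if n is m.+1 then << m >> else 0).
Let H : V -> V := malg_ext (fun n => << lam n *g n >>).

Fact qgha_nontrivial : 1 \notin qgha_ideal.
Proof.
have linX : linear X by exact: linearP.
have linY : linear Y by exact: linearP.
have linH : linear H by exact: linearP.
have act0 p : free_act X Y H (horner_alg h p) 0 = 0 by apply: free_act0r.
have HU n : H << n >> = lam n *: << n >> by rewrite /H malg_extU scale1r malgU_scale.
have XU n : X << n >> = mu n.+1 *: << n.+1 >>.
  by rewrite /X malg_extU scale1r malgU_scale.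
have YU n : Y << n >> = if n is m.+1 then << m >> else 0.
  by rewrite /Y malg_extU scale1r.
have lin0 (A : V -> V) : linear A -> A 0 = 0.
  move=> linA; have /eqP := linA 1 0 0.
  by rewrite !scale1r addr0 -subr_eq0 opprD addrA subrr sub0r oppr_eq0 => /eqP.
have linZ (A : V -> V) c v : linear A -> A (c *: v) = c *: A v.
  by move=> linA; have := linA c v 0; rewrite (lin0 A) // !addr0.
have linD (A : V -> V) u v : linear A -> A (u + v) = A u + A v.
  by move=> linA; have := linA 1 u v; rewrite !scale1r.
have ext (A B : V -> V) : linear A -> linear B ->
    (forall n, A << n >> = B << n >>) -> forall v, A v = B v.
  move=> linA linB AB; elim/malg_ind => [|u v IHu IHv|c n].
  - by rewrite !lin0.
  - by rewrite !linD // IHu IHv.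
  - by rewrite malgU_scale !linZ // AB.
have linP p : linear (free_act X Y H (horner_alg h p)) by apply: free_act_linear.
have eigP p n : free_act X Y H (horner_alg h p) << n >> = p.[lam n] *: << n >>.
  by apply: free_act_horner_eigen.
have rels : qgha_relations X Y H.
  split; apply: ext.
  - by move=> c u v; rewrite linX linH.
  - by move=> c u v; rewrite linP linX.
  - by move=> n; rewrite eigP XU !linZ // XU HU !scalerA mulrC.
  - by move=> c u v; rewrite linH linY.
  - by move=> c u v; rewrite linY linP.
  - case=> [|n]; first by rewrite HU linZ // YU scaler0 act0.
    by rewrite HU linZ // !YU eigP.
  - move=> c u v; rewrite !(linX, linY) scalerDr opprD addrACA scalerBr !scalerA.
    by rewrite [q * c]mulrC.
  - exact: linP.
  - case=> [|n]; rewrite XU linZ // !YU eigP.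
      by rewrite lin0 // scaler0 subr0 /= mulr0 add0r.
    by rewrite XU scalerA -scalerBl /= [_ + g.[_]]addrC addrK.
apply/negP => /(free_act_ideal linX linY linH rels)/(_ << 0%N >>).
rewrite free_act1 => /eqP.
by rewrite monalgU_eq0 oner_eq0.
Qed.

End Nontrivial.

Fact qgha_mul_subproof (a a' b b' : free_xyh F) :
  qgha_pi a = qgha_pi a' -> qgha_pi b = qgha_pi b' ->
  qgha_pi (a * b) = qgha_pi (a' * b').
Proof.
move=> /quot_piP/asboolP Ia /quot_piP/asboolP Ib; apply/quot_piP/asboolP.
have -> : a * b - a' * b' = (a - a') * b + a' * (b - b').
  by rewrite mulrBl mulrBr addrA subrK.
by apply: qgha_idealD; [apply: qgha_idealMr | apply: qgha_idealMl].
Qed.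

Definition qgha_one : qgha := qgha_pi 1.
Definition qgha_mul (a b : qgha) : qgha := locked (qgha_pi (repr a * repr b)).

Lemma qgha_mulE a b : qgha_mul (qgha_pi a) (qgha_pi b) = qgha_pi (a * b).
Proof.
rewrite /qgha_mul -lock; apply: qgha_mul_subproof; by rewrite /qgha_pi /quot_pi reprK. Qed.

Lemma qgha_pi_surj (a : qgha) : exists b, a = qgha_pi b.
Proof. exact: quot_pi_surj. Qed.

Fact qgha_mulA : associative qgha_mul.
Proof.
move=> a b c; have [a' ->] := qgha_pi_surj a.
have [b' ->] := qgha_pi_surj b; have [c' ->] := qgha_pi_surj c.
by rewrite !qgha_mulE mulrA.
Qed.

Fact qgha_mul1l : left_id qgha_one qgha_mul.
Proof. by move=> a; have [a' ->] := qgha_pi_surj a; rewrite qgha_mulE mul1r. Qed.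

Fact qgha_mul1r : right_id qgha_one qgha_mul.
Proof. by move=> a; have [a' ->] := qgha_pi_surj a; rewrite qgha_mulE mulr1. Qed.

Lemma qgha_piD a b : qgha_pi (a + b) = qgha_pi a + qgha_pi b.
Proof. exact: quot_piD. Qed.

Fact qgha_mulDl : left_distributive qgha_mul +%R.
Proof.
move=> a b c; have [a' ->] := qgha_pi_surj a.
have [b' ->] := qgha_pi_surj b; have [c' ->] := qgha_pi_surj c.
by rewrite -qgha_piD !qgha_mulE mulrDl qgha_piD.
Qed.

Fact qgha_mulDr : right_distributive qgha_mul +%R.
Proof.
move=> a b c; have [a' ->] := qgha_pi_surj a.
have [b' ->] := qgha_pi_surj b; have [c' ->] := qgha_pi_surj c.
by rewrite -qgha_piD !qgha_mulE mulrDr qgha_piD.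
Qed.

Fact qgha_one_neq0 : qgha_one != 0.
Proof.
apply/eqP => e; have := qgha_nontrivial; rewrite -[1]subr0.
suff -> : 1 - 0 \in qgha_ideal by [].
by apply/quot_piP; rewrite linear0.
Qed.

HB.instance Definition _ := GRing.Zmodule_isNzRing.Build qgha
  qgha_mulA qgha_mul1l qgha_mul1r qgha_mulDl qgha_mulDr qgha_one_neq0.

Lemma qgha_piM a b : qgha_pi (a * b) = qgha_pi a * qgha_pi b.
Proof. by rewrite -qgha_mulE. Qed.

Lemma qgha_piZ c a : qgha_pi (c *: a) = c *: qgha_pi a.
Proof. exact: linearZ_LR. Qed.

Fact qgha_scaleAl (c : F) (a b : qgha) : c *: (a * b) = c *: a * b.
Proof.
have [a' ->] := qgha_pi_surj a; have [b' ->] := qgha_pi_surj b.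
by rewrite -qgha_piM -!qgha_piZ -qgha_piM scalerAl.
Qed.

HB.instance Definition _ := GRing.Lmodule_isLalgebra.Build F qgha qgha_scaleAl.

Fact qgha_scaleAr (c : F) (a b : qgha) : c *: (a * b) = a * (c *: b).
Proof.
have [a' ->] := qgha_pi_surj a; have [b' ->] := qgha_pi_surj b.
by rewrite -qgha_piM -!qgha_piZ -qgha_piM scalerAr.
Qed.

HB.instance Definition _ := GRing.Lalgebra_isAlgebra.Build F qgha qgha_scaleAr.

Definition qgha_x : qgha := qgha_pi x.
Definition qgha_y : qgha := qgha_pi y.
Definition qgha_h : qgha := qgha_pi h.

Lemma qgha_pi_horner p : qgha_pi (horner_alg h p) = horner_alg qgha_h p.
Proof.
elim/poly_ind: p => [|p c IHp]; first by rewrite !rmorph0; apply: linear0.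
rewrite !rmorphD !rmorphM /= !horner_algX !horner_algC.
by rewrite qgha_piD qgha_piM IHp qgha_piZ.
Qed.

Lemma qgha_hx : qgha_h * qgha_x = qgha_x * horner_alg qgha_h f.
Proof.
rewrite -qgha_pi_horner -!qgha_piM.
by apply/quot_piP/asboolP; apply: qgha_rel_hx.
Qed.

Lemma qgha_yh : qgha_y * qgha_h = horner_alg qgha_h f * qgha_y.
Proof.
rewrite -qgha_pi_horner -!qgha_piM.
by apply/quot_piP/asboolP; apply: qgha_rel_yh.
Qed.

Lemma qgha_yx : qgha_y * qgha_x - q *: (qgha_x * qgha_y) = horner_alg qgha_h g.
Proof.
apply/eqP; rewrite subr_eq -qgha_pi_horner -!qgha_piM -qgha_piZ -qgha_piD.
apply/eqP/quot_piP/asboolP; rewrite opprD addrA addrAC.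
exact: qgha_rel_yx.
Qed.

End Algebra.


(* The nonnegative generator of a subgroup of Z; see [zgenP].
   Junk value 0 when P is not a subgroup. *)
Definition zgen (P : set int) : nat :=
  xget 0%N [set n : nat | forall k : int, P k <-> (n%:Z %| k)%Z].

Lemma zgenP (P : set int) :
  P 0 -> (forall k l, P k -> P l -> P (k - l)) ->
  forall k, P k <-> ((zgen P)%:Z %| k)%Z.
Proof.
move=> P0 PB; rewrite /zgen; case: xgetP => [n _ //|noP].
have PN k : P k -> P (- k) by move=> Pk; rewrite -sub0r; apply: PB.
have PD k l : P k -> P l -> P (k + l).
  by move=> Pk Pl; rewrite -[l]opprK; apply/PB/PN.
have PMn k n : P k -> P (n%:Z * k).
  move=> Pk; elim: n => [|n IHn]; first by rewrite mul0r.
  by rewrite -addn1 PoszD mulrDl mul1r; apply: PD.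
have PMz k (m : int) : P k -> P (m * k).
  move=> Pk; case: m => n; first exact: PMn.
  by rewrite NegzE mulNr; apply/PN/PMn.
have [[n [n0 Pn]]|noposP] := pselect (exists n, (0 < n)%N /\ P n%:Z); last first.
  exfalso; apply: (noP 0%N) => k /=; rewrite dvd0z; split=> [Pk|/eqP-> //].
  apply/negPn/negP => k0; apply: noposP; exists `|k|%N; split.
    by rewrite absz_gt0.
  by case: k Pk {k0} => n // /PN.
have exP : exists n, [&& (0 < n)%N & `[< P n%:Z >]].
  by exists n; rewrite n0; apply/asboolP.
case: (ex_minnP exP) => m /andP[m0 /asboolP Pm] minm.
exfalso; apply: (noP m) => k /=; split=> [Pk|/dvdzP[l ->]]; last exact: PMz.
have Pmod : P (k %% m%:Z)%Z.
  by rewrite /modz; apply/PB/PMz.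
have m0' : m%:Z != 0 by rewrite eqz_nat -lt0n.
have := modz_ge0 k m0'; case E: (k %% m%:Z)%Z Pmod => [r|//] Pr _.
have rm : (r < m)%N.
  by rewrite -ltz_nat -E ltz_pmod.
case: r => [|r] in E Pr rm *; first exact/dvdz_mod0P.
by have := minm r.+1; rewrite (asboolT Pr) => /(_ isT); rewrite leqNgt rm.
Qed.

Record Sf (F : fieldType) (f : {poly F}) := MkSf {
  Sf_fun :> int -> F;
  Sf_step : forall i, f.[Sf_fun i] = Sf_fun (i + 1)
}.

Definition Sf_per (F : fieldType) (f : {poly F}) (lam : Sf f) : nat :=
  zgen [set k : int | forall i, lam i = lam (i + k)].

Record Tqg (F : fieldType) (q : F) (f g : {poly F}) (lam : Sf f) := MkTqg {
  Tqg_fun :> int -> F;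
  Tqg_step : forall i, Tqg_fun (i + 1) = q * Tqg_fun i + g.[lam i]
}.

(* The set below is a subgroup of Z when q != 0; see [Tqg_perP]. *)
Definition Tqg_per (F : fieldType) (q : F) (f g : {poly F}) (lam : Sf f)
    (mu : Tqg q g lam) : nat :=
  zgen [set k : int | mu (k * (Sf_per lam)%:Z) = mu 0].

Section Periods.
Variables (F : fieldType) (q : F) (f g : {poly F}) (lam : Sf f).
Variable mu : Tqg q g lam.

Lemma Sf_perP k : (forall i, lam i = lam (i + k)) <-> ((Sf_per lam)%:Z %| k)%Z.
Proof.
apply: (zgenP (P := [set k : int | forall i, lam i = lam (i + k)])) => /=.
  by move=> i; rewrite addr0.
by move=> m n Pm Pn i; rewrite (Pn (i + (m - n))) -addrA subrK.
Qed.

Lemma Tqg_shift (d : int) : q != 0 -> (forall i, lam (i + d) = lam i) ->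
  mu d = mu 0 -> forall i, mu (i + d) = mu i.
Proof.
move=> q0 lamd mud; apply: int_rect => [|n IHn|n IHn]; first by rewrite add0r.
  rewrite -addn1 PoszD [_ + 1 + d]addrAC !Tqg_step IHn.
  by rewrite lamd.
have step (i : int) : mu (i + 1 + d) = mu (i + 1) -> mu (i + d) = mu i.
  by rewrite addrAC !Tqg_step lamd => /addIr/(mulfI q0).
by apply: step; rewrite -addn1 PoszD opprD subrK.
Qed.

Lemma lam_mulper (k i : int) : lam (i + k * (Sf_per lam)%:Z) = lam i.
Proof. by symmetry; apply/Sf_perP: i; apply: dvdz_mull. Qed.

Lemma Tqg_perP k : q != 0 ->
  mu (k * (Sf_per lam)%:Z) = mu 0 <-> ((Tqg_per mu)%:Z %| k)%Z.
Proof.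
move=> q0.
apply: (zgenP (P := [set k : int | mu (k * (Sf_per lam)%:Z) = mu 0])) => /=.
  by rewrite mul0r.
move=> m n Pm Pn; rewrite mulrBl.
by rewrite -(Tqg_shift q0 (lam_mulper n) Pn) subrK.
Qed.

Definition Bper : nat := (Sf_per lam * Tqg_per mu)%N.

Lemma lam_Bper i : lam (i + Bper%:Z) = lam i.
Proof. by rewrite /Bper mulnC PoszM lam_mulper. Qed.

Lemma mu_Bper i : mu (i + Bper%:Z) = mu i.
Proof.
have [q0|q0] := eqVneq q 0.
  rewrite -[in LHS](subrK 1 i) -[in RHS](subrK 1 i) addrAC !Tqg_step.
  by have qM0 c : q * c = 0; rewrite ?q0 ?mul0r // !qM0 lam_Bper.
apply: Tqg_shift => //; first exact: lam_Bper.
rewrite /Bper mulnC PoszM; apply/Tqg_perP => //; exact: dvdzz.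
Qed.

End Periods.

Definition laurent (F : fieldType) := {malg F[int]}.
HB.instance Definition _ (F : fieldType) :=
  GRing.Lmodule.copy (laurent F) {malg F[int]}.

Section Laurent.
Variable F : fieldType.

HB.instance Definition _ := GRing.Zmodule_isComNzRing.Build (laurent F)
  (malg_convA (@addrA int)) (malg_convC (@addrC int))
  (malg_conv1l (@add0r int)) (@malg_convDl F _ +%R) (malg_one_neq0 F (0 : int)).

Fact laurent_scaleAl (c : F) (a b : laurent F) : c *: (a * b) = c *: a * b.
Proof. by rewrite [RHS]malg_convZl. Qed.

HB.instance Definition _ :=
  GRing.Lmodule_isLalgebra.Build F (laurent F) laurent_scaleAl.
HB.instance Definition _ := GRing.Lalgebra_isComAlgebra.Build F (laurent F).

Definition tpow (i : int) : laurent F := << i >>.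

Lemma tpow0 : tpow 0 = 1. Proof. by []. Qed.

Lemma tpowD i j : tpow (i + j) = tpow i * tpow j.
Proof. by rewrite [RHS]malg_convUU mulr1. Qed.

Lemma laurent_ext (V : lmodType F) (A B : laurent F -> V) :
  linear A -> linear B -> (forall i, A (tpow i) = B (tpow i)) ->
  forall p, A p = B p.
Proof.
move=> linA linB AB p.
pose A' : {linear laurent F -> V} := HB.pack A (GRing.isLinear.Build F _ V *:%R A linA).
pose B' : {linear laurent F -> V} := HB.pack B (GRing.isLinear.Build F _ V *:%R B linB).
rewrite -[A]/(A' : _ -> _) -[B]/(B' : _ -> _).
elim/malg_ind: p => [|p r IHp IHr|c i]; first by rewrite !linear0.
  by rewrite !linearD IHp IHr.
by rewrite malgU_scale !linearZ_LR /= AB.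
Qed.

End Laurent.

Section Bmodule.
Variables (F : fieldType) (q : F) (f g : {poly F}) (lam : Sf f).
Variable mu : Tqg q g lam.

Local Notation t := (tpow F).

Definition Bh : laurent F -> laurent F := malg_ext (fun i => lam i *: t i).
Definition Bx : laurent F -> laurent F :=
  malg_ext (fun i => mu (i + 1) *: t (i + 1)).
Definition By : laurent F -> laurent F := malg_ext (fun i => t (i - 1)).

Lemma BhE i : Bh (t i) = lam i *: t i.
Proof. by rewrite /Bh malg_extU scale1r. Qed.

Lemma BxE i : Bx (t i) = mu (i + 1) *: t (i + 1).
Proof. by rewrite /Bx malg_extU scale1r. Qed.

Lemma ByE i : By (t i) = t (i - 1).
Proof. by rewrite /By malg_extU scale1r. Qed.

Let linBh : linear Bh. Proof. exact: malg_ext_linear. Qed.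
Let linBx : linear Bx. Proof. exact: malg_ext_linear. Qed.
Let linBy : linear By. Proof. exact: malg_ext_linear. Qed.

Local Notation act := (free_act Bx By Bh).

Let linZ (A : laurent F -> laurent F) c v : linear A -> A (c *: v) = c *: A v.
Proof.
move=> linA; have A0 : A 0 = 0.
  by apply: (addrI (A 0)); have := linA 1 0 0; rewrite !scale1r !addr0.
by have := linA c v 0; rewrite A0 !addr0.
Qed.

Let linact a : linear (act a).
Proof. exact: free_act_linear. Qed.

Let lin_comp (A B : laurent F -> laurent F) :
  linear A -> linear B -> linear (fun v => A (B v)).
Proof. by move=> linA linB c u v; rewrite linB linA. Qed.

Fact B_relations : qgha_relations q f g Bx By Bh.
Proof.
have eigP p i : act (horner_alg (free_gen F Gh) p) (t i) = p.[lam i] *: t i.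
  by apply: free_act_horner_eigen => //; rewrite BhE.
split; apply: laurent_ext => //; try exact: lin_comp.
- by move=> i; rewrite eigP BxE !linZ // BxE BhE !scalerA Sf_step mulrC.
- move=> i; rewrite BhE linZ // ByE eigP Sf_step.
  by rewrite subrK.
- move=> c u v; rewrite !(linBx, linBy) scalerDr opprD addrACA scalerBr !scalerA.
  by rewrite [q * c]mulrC.
- move=> i; rewrite BxE linZ // !ByE BxE addrK subrK eigP scalerA -scalerBl.
  by rewrite Tqg_step addrC addKr.
Qed.

(* The underlying additive group of B(lam, mu); its scalars are H_q(f, g). *)
Definition Bmod of Tqg q g lam := laurent F.
Local Notation B := (Bmod mu).
HB.instance Definition _ := GRing.Zmodule.copy B (laurent F).

Definition B_scale (a : qgha q f g) (v : B) : B := qgha_act Bx By Bh a v.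

Lemma B_scaleE a (v : laurent F) : B_scale (qgha_pi q f g a) v = act a v.
Proof. by apply: qgha_actE => //; apply: B_relations. Qed.

Fact B_scaleA a b v : B_scale a (B_scale b v) = B_scale (a * b) v.
Proof.
have [a' ->] := qgha_pi_surj a; have [b' ->] := qgha_pi_surj b.
by rewrite -qgha_piM !B_scaleE; symmetry; apply: free_actM.
Qed.

Fact B_scale1 : left_id 1 B_scale.
Proof.
move=> v; rewrite -[1]/(qgha_pi q f g 1) B_scaleE; exact: free_act1.
Qed.

Fact B_scaleDr : right_distributive B_scale +%R.
Proof.
move=> a u v; have [a' ->] := qgha_pi_surj a; rewrite !B_scaleE.
exact: free_actDr.
Qed.

Fact B_scaleDl v : {morph B_scale^~ v : a b / a + b}.
Proof.
move=> a b; have [a' ->] := qgha_pi_surj a; have [b' ->] := qgha_pi_surj b.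
by rewrite -qgha_piD !B_scaleE; apply: free_actDl.
Qed.

HB.instance Definition _ := GRing.Zmodule_isLmodule.Build (qgha q f g) B
  B_scaleA B_scale1 B_scaleDr B_scaleDl.

Definition Btpow (i : int) : B := t i.

Lemma B_scaleC (c : F) (v : laurent F) : c%:A *: (v : B) = (c *: v : laurent F).
Proof.
have -> : c%:A = qgha_pi q f g c%:A by rewrite qgha_piZ.
rewrite /GRing.scale /= B_scaleE free_actZl free_act1 //.
Qed.

Lemma B_hE i : qgha_h q f g *: Btpow i = (lam i *: t i : laurent F).
Proof. by rewrite -BhE /GRing.scale /= B_scaleE free_act_gen. Qed.

Lemma B_xE i : qgha_x q f g *: Btpow i = (mu (i + 1) *: t (i + 1) : laurent F).
Proof. by rewrite -BxE /GRing.scale /= B_scaleE free_act_gen. Qed.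

Lemma B_yE i : qgha_y q f g *: Btpow i = Btpow (i - 1).
Proof. by rewrite /Btpow -ByE /GRing.scale /= B_scaleE free_act_gen. Qed.

(* The ideal of F[t, t^-1] generated by t^(|lam| |mu|) - gamma. *)
Definition B_ideal (gamma : F) : {pred B} :=
  fun p => `[< exists r : laurent F,
    p = r * (t (Sf_per lam * Tqg_per mu)%N%:Z - gamma%:A) >].

Variable gamma : F.
Local Notation N := (Bper mu).
Local Notation z := (t N%:Z - gamma%:A).

Let opM (A : laurent F -> laurent F) : linear A ->
  (forall i, A (t (i + N%:Z)) = A (t i) * t N%:Z) ->
  forall r, A (r * z) = A r * z.
Proof.
move=> linA AN; apply: laurent_ext.
- by move=> c u v; rewrite mulrDl -scalerAl linA.
- by move=> c u v; rewrite linA mulrDl -scalerAl.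
move=> i; rewrite !mulrBr -!scalerAr !mulr1 -tpowD -AN.
by rewrite addrC -scaleNr linA scaleNr addrC.
Qed.

Let actM a (r : laurent F) : act a (r * z) = act a r * z.
Proof.
elim/free_xyh_ind: a r => [|a b IHa IHb|c w] r.
- by rewrite !free_act0l mul0r.
- by rewrite !free_actDl mulrDl IHa IHb.
rewrite !free_act_word -scalerAl; congr (_ *: _).
elim: w => [|j w IHw] //=; rewrite IHw.
case: j => /=; apply: opM => // i.
- rewrite !BxE -scalerAl -tpowD addrAC mu_Bper; congr (_ *: t _).
- by rewrite !ByE -tpowD addrAC.
- by rewrite !BhE -scalerAl -tpowD lam_Bper.
Qed.

Fact B_ideal_submod : submod_closed (B_ideal gamma).
Proof.
split=> [|a u v]; first by apply/asboolP; exists 0; rewrite mul0r.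
move=> /asboolP[r ->] /asboolP[s ->]; apply/asboolP.
have [a' ->] := qgha_pi_surj a; exists (act a' r + s).
by rewrite mulrDl -actM -B_scaleE.
Qed.

HB.instance Definition _ :=
  GRing.isSubmodClosed.Build (qgha q f g) B (B_ideal gamma) B_ideal_submod.

End Bmodule.

Arguments Bmod {F q f g} lam mu.
Arguments B_ideal {F q f g lam} mu gamma _.
Arguments Btpow {F q f g lam} mu i.

Definition Bquot (F : fieldType) (q : F) (f g : {poly F}) (lam : Sf f)
  (mu : Tqg q g lam) (gamma : F) := quot_mod (B_ideal mu gamma).
HB.instance Definition _ (F : fieldType) (q : F) (f g : {poly F}) (lam : Sf f)
    (mu : Tqg q g lam) (gamma : F) :=
  GRing.Lmodule.on (@Bquot F q f g lam mu gamma).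
Arguments Bquot {F q f g} lam mu gamma.

(* Main.v *)
Require Import Defs.
From HB Require Import structures.
From mathcomp Require Import all_boot all_algebra.
From mathcomp.multinomials Require Import monalg.
From mathcomp Require Import boolp.

Set Implicit Arguments.
Unset Strict Implicit.
Unset Printing Implicit Defensive.

Import GRing.Theory.
Local Open Scope ring_scope.

(** Let [N] be [Bper mu], the product of the two periods: it generates the
    group of common periods of [lam] and [mu]. In the quotient module the class
    of [t^(i + N)] is [gamma] times the class of [t^i], so the classes of
    [t^0, ..., t^(N-1)] form a basis, in which [h] and [x * y] act diagonally
    with eigenvalues [lam i] and [mu i].

    Suppose that [phi] is an isomorphism. It sends the class of [t^0] to a
    nonzero joint eigenvector of [h] and [x * y] with eigenvalues [lam 0] and
    [mu 0]. A nonzero coordinate of this vector, the [k]-th say, gives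
    [lam' k = lam 0] and [mu' k = mu 0] ([joint_eigenvector]). Both pairs of
    sequences obey the same recurrence, which carries this equality forwards,
    and periodicity carries it backwards, so the primed pair is the unprimed
    one shifted by [- k] ([shift_of_agree]). Two divisions with remainder write
    [- k] as [i + j * |lam|] modulo [N]. Being shifts of each other, the pairs
    have the same common period ([Bper_shift]); as [y^N] acts on the two
    modules as the scalars [gamma^-1] and [gamma'^-1] ([Bquot_yN]), it follows
    that [gamma = gamma'].

    Conversely, if the primed pair is the unprimed one shifted by [m], then
    multiplication by [t^(-m)] commutes with [x], [y] and [h], hence is linear
    over the whole algebra ([qgha_linear]), and maps the ideal generated by
    [t^N - gamma] to itself. It therefore induces a map of the quotients
    ([Bquot_shift]), with inverse induced by multiplication by [t^m]. *)

(** * Linear maps and quotients *)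

Section QuotLift.
Variables (R : pzRingType) (V W : lmodType R).
Variables (S : submodClosed V) (T : submodClosed W) (psi : {linear V -> W}).
Hypothesis psiS : forall v, v \in S -> psi v \in T.

Lemma quot_lift_exists : exists phi : {linear quot_mod S -> quot_mod T},
  forall v, phi (quot_pi S v) = quot_pi T (psi v).
Proof.
pose phi (x : quot_mod S) : quot_mod T := quot_pi T (psi (repr x)).
have phiE v : phi (quot_pi S v) = quot_pi T (psi v).
  apply/quot_piP; rewrite -linearB; apply: psiS.
  by apply/quot_piP; rewrite /quot_pi reprK.
have linphi : linear phi.
  move=> a x y; have [u ->] := quot_pi_surj x; have [v ->] := quot_pi_surj y.
  by rewrite -linearP !phiE !linearP.
pose philin : {linear quot_mod S -> quot_mod T} :=
  HB.pack phi (GRing.isLinear.Build R _ _ *:%R phi linphi).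
by exists philin.
Qed.

End QuotLift.

Lemma linear_scale_eq (R : pzRingType) (V W : lmodType R)
    (phi : {linear V -> W}) (a b : R) (v : V) :
  a *: v = b *: v -> a *: phi v = b *: phi v.
Proof. by rewrite -!linearZ => ->. Qed.

(** The ground field acts on a module over an [F]-algebra [A] through the
    scalars [c%:A]. They are treated here over an abstract [A], where
    unification need not unfold the construction of a particular algebra. *)
Section ScalarAction.
Variables (F : fieldType) (A : algType F) (V : lmodType A).
Implicit Types (a : A) (c d : F) (v : V).

Lemma scaleAC a c v : a *: (c%:A *: v) = c%:A *: (a *: v).
Proof. by rewrite !scalerA mulr_algl mulr_algr. Qed.

Lemma scaleAA c d v : c%:A *: (d%:A *: v) = (c * d)%:A *: v.
Proof. by rewrite scalerA mulr_algl scalerA. Qed.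

Lemma scale1A v : (1 : F)%:A *: v = v.
Proof. by rewrite !scale1r. Qed.

Lemma scaleA_inj v : v != 0 -> injective (fun c => c%:A *: v).
Proof.
move=> v0 c d cd; apply: contraNeq v0; rewrite -subr_eq0 => cd0.
rewrite -[v]scale1A -(mulVf cd0) -scaleAA 2!scalerBl.
by rewrite cd subrr scaler0.
Qed.

Lemma scale_period (N : int) (c : F) (e : int -> V) : c != 0 ->
  (forall i, e (i + N) = c%:A *: e i) ->
  forall i l, e (i + l * N) = (c ^ l)%:A *: e i.
Proof.
move=> c0 eN; have eB j : e (j - N) = (c^-1)%:A *: e j.
  by rewrite -[in RHS](subrK N j) eN scaleAA mulVf // scale1A.
move=> i; elim/int_rect => [|l IHl|l IHl].
- by rewrite mul0r addr0 expr0z scale1A.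
- have -> : i + l.+1%:Z * N = (i + l%:Z * N) + N.
    by rewrite -addn1 PoszD mulrDl mul1r addrA.
  by rewrite eN IHl scaleAA -addn1 PoszD expfzDr // expr1z mulrC.
have -> : i + - l.+1%:Z * N = (i + - l%:Z * N) - N.
  by rewrite -addn1 PoszD opprD mulrBl mul1r addrA.
by rewrite eB IHl scaleAA -addn1 PoszD opprD expfzDr // exprN1 mulrC.
Qed.

End ScalarAction.

(** The algebra is spanned by the words in its three generators, so commuting
    with these and with the scalars is enough. *)
Lemma qgha_linear (F : fieldType) (q : F) (f g : {poly F})
    (V W : lmodType (qgha q f g)) (psi : V -> W) :
  {morph psi : u v / u + v} ->
  (forall (c : F) v, psi (c%:A *: v) = c%:A *: psi v) ->
  (forall v, psi (qgha_x q f g *: v) = qgha_x q f g *: psi v) ->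
  (forall v, psi (qgha_y q f g *: v) = qgha_y q f g *: psi v) ->
  (forall v, psi (qgha_h q f g *: v) = qgha_h q f g *: psi v) ->
  linear psi.
Proof.
move=> psiD psiC psix psiy psih a u v; rewrite psiD; congr (_ + _).
have psi0 : psi 0 = 0 by apply: (addrI (psi 0)); rewrite -psiD !addr0.
have [b ->] := qgha_pi_surj a => {a v}.
elim/free_xyh_ind: b u => [|a b IHa IHb|c w] u.
- by rewrite /qgha_pi linear0 !scale0r.
- by rewrite qgha_piD !scalerDl psiD IHa IHb.
elim: w u => [|i w IHw] u.
  rewrite malgU_scale -[<< _ >>]/(1 : free_xyh F) qgha_piZ; exact: psiC.
have -> : << c *g i :: w >> = free_gen F i * << c *g w >> :> free_xyh F.
  by rewrite /free_gen free_xyhUU mul1r.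
by rewrite qgha_piM -!scalerA -IHw; case: i; [apply: psix | apply: psiy | apply: psih].
Qed.

(** * The joint period of a pair of sequences *)

(** A common period is first a period of [lam], that is, a multiple
    [l * |lam|]; then [mu (l * |lam|) = mu 0] says that [|mu|] divides [l]. *)
Lemma Bper_dvdP (F : fieldType) (q : F) (f g : {poly F}) (lam : Sf f)
    (mu : Tqg q g lam) (k : int) : q != 0 ->
  ((Bper mu)%:Z %| k)%Z <->
  (forall i, lam (i + k) = lam i) /\ (forall i, mu (i + k) = mu i).
Proof.
move=> q0; split=> [/dvdzP[l ->]|[lamk muk]].
  rewrite /Bper mulnC PoszM mulrA; split=> i; first exact: lam_mulper.
  apply: Tqg_shift => // [j|]; first exact: lam_mulper.
  by apply/Tqg_perP => //; apply: dvdz_mull.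
have /dvdzP[l kE] : ((Sf_per lam)%:Z %| k)%Z.
  by apply/Sf_perP => i; rewrite lamk.
rewrite /Bper kE mulnC PoszM dvdz_mul //.
by apply/Tqg_perP => //; rewrite -kE -[k]add0r muk.
Qed.

Section Shift.
Variables (F : fieldType) (q : F) (f g : {poly F}) (lam lam' : Sf f).
Variables (mu : Tqg q g lam) (mu' : Tqg q g lam').
Hypothesis q_neq0 : q != 0.

Lemma Bper_shift (m : int) : (forall k, lam' k = lam (k + m)) ->
  (forall k, mu' k = mu (k + m)) -> Bper mu' = Bper mu.
Proof.
move=> lamm mum; apply/eqP; rewrite eqn_dvd; apply/andP; split.
  apply/(@Bper_dvdP _ _ _ _ _ mu' (Bper mu)%:Z q_neq0); split=> i.
    by rewrite !lamm addrAC lam_Bper.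
  by rewrite !mum addrAC mu_Bper.
apply/(@Bper_dvdP _ _ _ _ _ mu (Bper mu')%:Z q_neq0); split=> i.
  by rewrite -[i](subrK m) [_ + m + _]addrAC -!lamm lam_Bper.
by rewrite -[i](subrK m) [_ + m + _]addrAC -!mum mu_Bper.
Qed.

Hypotheses (per_gt0 : (0 < Bper mu)%N) (per'_gt0 : (0 < Bper mu')%N).

(** The recurrences determine the later terms from one term. An earlier index
    is first moved to a nonnegative one by a large enough common multiple [d]
    of the two joint periods. *)
Lemma shift_of_agree (m : int) : lam' m = lam 0 -> mu' m = mu 0 ->
  (forall k, lam' (k + m) = lam k) /\ (forall k, mu' (k + m) = mu k).
Proof.
move=> lam0 mu0.
have fwd (n : nat) : lam' (n%:Z + m) = lam n%:Z /\ mu' (n%:Z + m) = mu n%:Z.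
  elim: n => [|n [IHl IHm]]; first by rewrite add0r.
  by rewrite -addn1 PoszD addrAC -!Sf_step !Tqg_step IHl IHm.
suff all k : lam' (k + m) = lam k /\ mu' (k + m) = mu k.
  by split=> k; have [] := all k.
pose d := (`|k|%N * (Bper mu * Bper mu'))%N.
have [lamd mud] : (forall i, lam (i + d%:Z) = lam i) /\
    (forall i, mu (i + d%:Z) = mu i).
  apply/(@Bper_dvdP _ _ _ _ _ mu d%:Z q_neq0).
  by rewrite -[(_ %| _)%Z]/(_ %| _)%N dvdn_mull // dvdn_mulr.
have [lamd' mud'] : (forall i, lam' (i + d%:Z) = lam' i) /\
    (forall i, mu' (i + d%:Z) = mu' i).
  apply/(@Bper_dvdP _ _ _ _ _ mu' d%:Z q_neq0).
  by rewrite -[(_ %| _)%Z]/(_ %| _)%N dvdn_mull // dvdn_mull.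
have [n kd] : exists n : nat, k + d%:Z = n%:Z.
  have : (`|k| <= d)%N by rewrite leq_pmulr // muln_gt0 per_gt0.
  case: k @d {lamd mud lamd' mud'} => k d /= kd; first by exists (k + d)%N.
  by exists (d - k.+1)%N; rewrite NegzE addrC subzn.
have [] := fwd n.
by rewrite -kd addrAC lamd lamd' mud mud'.
Qed.

End Shift.

(** * Coordinates on the quotient module *)

Section Quotient.
Variables (F : fieldType) (q : F) (f g : {poly F}) (lam : Sf f).
Variables (mu : Tqg q g lam) (gamma : F).
Hypothesis gamma_neq0 : gamma != 0.

Local Notation B := (Bmod lam mu).
Local Notation N := (Bper mu).
Local Notation t := (tpow F).
Local Notation pi := (quot_pi (B_ideal mu gamma)).
Local Notation e i := (pi (Btpow mu i)).

(** Stated with the scalars [c%:A] of the algebra, so that the induction stays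
    within the module structure of [B]. *)
Lemma Bmod_ind (P : B -> Prop) :
  (forall u v, P u -> P v -> P (u + v)) ->
  (forall c i, P (c%:A *: Btpow mu i)) -> forall v, P v.
Proof.
move=> PD PU; apply: malg_ind => [|u v Pu Pv|c i]; last 1 first.
- by have := PU c i; rewrite B_scaleC malgU_scale.
- by have := PU 0 0; rewrite scale0r scale0r.
- exact: PD.
Qed.

Lemma B_hC i : qgha_h q f g *: Btpow mu i = (lam i)%:A *: Btpow mu i.
Proof. by rewrite B_hE B_scaleC. Qed.

Lemma B_xC i :
  qgha_x q f g *: Btpow mu i = (mu (i + 1))%:A *: Btpow mu (i + 1).
Proof. by rewrite B_xE B_scaleC. Qed.

Lemma B_xyC i :
  (qgha_x q f g * qgha_y q f g) *: Btpow mu i = (mu i)%:A *: Btpow mu i.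
Proof. by rewrite -scalerA B_yE B_xC subrK. Qed.

Lemma B_yn n i : qgha_y q f g ^+ n *: Btpow mu i = Btpow mu (i - n%:Z).
Proof.
elim: n i => [|n IHn] i; first by rewrite expr0 scale1r subr0.
by rewrite exprSr -scalerA B_yE IHn -addn1 PoszD opprD addrA addrAC.
Qed.

Lemma Btpow_modN (i : int) : e (i + N%:Z) = gamma%:A *: e i.
Proof.
rewrite -linearZ; apply/quot_piP/asboolP; exists (t i).
by rewrite B_scaleC mulrBr -tpowD mulr_algr.
Qed.

Lemma Btpow_modNM (i l : int) : e (i + l * N%:Z) = (gamma ^ l)%:A *: e i.
Proof.
exact: (scale_period (e := fun i => e i) gamma_neq0 Btpow_modN).
Qed.

(** The [k]-th coordinate modulo [t^N - gamma]: the monomial [t^(k + l * N)]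
    counts as [gamma^l * t^k]. *)
Definition Bcoef (k : int) : B -> F :=
  malg_ext (V := F^o)
    (fun i => if (N%:Z %| i - k)%Z then gamma ^ ((i - k) %/ N%:Z)%Z else 0).

Lemma Bcoef_linear k (c : F) (u v : laurent F) :
  Bcoef k (c *: u + v : laurent F) = c * Bcoef k u + Bcoef k v.
Proof. exact: (malg_ext_linear (V := F^o)). Qed.

Lemma BcoefD k u v : Bcoef k (u + v) = Bcoef k u + Bcoef k v.
Proof.
have := Bcoef_linear k 1 u v; rewrite mul1r => <-; congr (Bcoef k _).
by rewrite scale1r.
Qed.

Lemma Bcoef0 k : Bcoef k 0 = 0.
Proof. by apply: (addrI (Bcoef k 0)); rewrite -BcoefD !addr0. Qed.

Lemma BcoefC k c v : Bcoef k (c%:A *: v) = c * Bcoef k v.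
Proof.
by have := Bcoef_linear k c v 0; rewrite Bcoef0 !addr0 B_scaleC.
Qed.

Lemma BcoefB k u v : Bcoef k (u - v) = Bcoef k u - Bcoef k v.
Proof. by apply/eqP; rewrite eq_sym subr_eq -BcoefD subrK. Qed.

Lemma Bcoef_tpow k i : Bcoef k (Btpow mu i) =
  if (N%:Z %| i - k)%Z then gamma ^ ((i - k) %/ N%:Z)%Z else 0.
Proof. by rewrite /Bcoef malg_extU scale1r. Qed.

Hypothesis N_gt0 : (0 < N)%N.

Lemma Bcoef_ideal k v : v \in B_ideal mu gamma -> Bcoef k v = 0.
Proof.
move=> /asboolP[r ->].
have N0 : N%:Z != 0 by rewrite eqz_nat -lt0n.
pose z : laurent F := t N%:Z - gamma%:A.
rewrite -[_ * _]/((r * z : laurent F) : B).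
elim/malg_ind: r => [|r s IHr IHs|c i].
- by rewrite mul0r; apply: Bcoef0.
- by rewrite mulrDl BcoefD IHr IHs addr0.
have -> : ((<< c *g i >> : laurent F) * z : B) =
    c%:A *: (Btpow mu (i + N%:Z) - gamma%:A *: Btpow mu i).
  rewrite !B_scaleC malgU_scale -scalerAl /z mulrBr mulr_algr.
  exact: (congr1 (fun w : laurent F => c *: (w - gamma *: t i)) (esym (tpowD F i _))).
rewrite BcoefC BcoefB BcoefC !Bcoef_tpow addrAC rpredDr ?dvdzz //.
case: ifP => _; last by rewrite mulr0 subrr mulr0.
by rewrite (divzDr (i - k) (dvdzz N%:Z)) divzz N0 expfzDr // expr1z [_ * gamma]mulrC subrr mulr0.
Qed.

(** Every [t^i] reduces to a scalar multiple of [t^r], with [r] the remainder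
    of [i] modulo [N]: the classes of [t^0, ..., t^(N-1)] span the quotient. *)
Lemma Bcoef_expand v : pi v = \sum_(k < N) (Bcoef k%:Z v)%:A *: e k%:Z.
Proof.
elim/Bmod_ind: v => [u v IHu IHv|c i].
  rewrite quot_piD IHu IHv -big_split /=; apply: eq_bigr => k _.
  by rewrite BcoefD -scalerDl -scalerDl.
have N0 : N%:Z != 0 by rewrite eqz_nat -lt0n.
have [r rE] : exists r : nat, (i %% N%:Z)%Z = r%:Z.
  by have := modz_ge0 i N0; case: (_ %% _)%Z => // r _; exists r.
have rN : (r < N)%N by rewrite -ltz_nat -rE ltz_pmod.
rewrite (bigD1 (Ordinal rN)) //= big1 ?addr0 => [|k kr].
  have iE : i - r%:Z = (i %/ N%:Z)%Z * N%:Z by rewrite -rE {1}(divz_eq i N%:Z) addrK.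
  rewrite BcoefC Bcoef_tpow iE dvdz_mull ?dvdzz // mulzK //.
  rewrite linearZ /= -{1}(subrK r%:Z i) iE addrC Btpow_modNM.
  exact: scaleAA.
rewrite BcoefC Bcoef_tpow ifN ?mulr0 ?scale0r //.
apply: contra kr => dvd; rewrite -val_eqE /= -eqz_nat -rE.
by rewrite eq_sym -[k%:Z](@modz_small _ N%:Z) ?ltz_nat ?ltn_ord // eqz_mod_dvd.
Qed.

(** The [k]-th coordinate only sees the monomials [t^(k + l * N)], on which an
    [N]-periodic family of eigenvalues takes the single value [s k]. *)
Lemma Bcoef_diag (u : qgha q f g) (s : int -> F) :
  (forall i, u *: Btpow mu i = (s i)%:A *: Btpow mu i) ->
  (forall i, s (i + N%:Z) = s i) ->
  forall k v, Bcoef k (u *: v) = s k * Bcoef k v.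
Proof.
move=> us sN k; have sM n i : s (i + n%:Z * N%:Z) = s i.
  elim: n => [|n IHn]; first by rewrite mul0r addr0.
  by rewrite -addn1 PoszD mulrDl mul1r addrA sN IHn.
elim/Bmod_ind => [v w IHv IHw|c i].
  by rewrite scalerDr !BcoefD IHv IHw mulrDr.
rewrite scaleAC us !BcoefC mulrCA Bcoef_tpow.
case: ifP => [/dvdzP[l il]|_]; last by rewrite !mulr0.
congr (_ * (_ * _)); have {il} -> : i = k + l * N%:Z by rewrite -il addrC subrK.
case: l => n; first exact: sM.
by rewrite -(sM n.+1) NegzE mulNr subrK.
Qed.

Lemma Btpow_class_neq0 i : e i != 0.
Proof.
apply/eqP => /esym e0; have : Btpow mu i \in B_ideal mu gamma.
  by rewrite -[Btpow mu i]subr0; apply/quot_piP; rewrite -e0 linear0.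
move/(Bcoef_ideal i); rewrite Bcoef_tpow subrr dvdz0 div0z expr0z.
by move/eqP; rewrite oner_eq0.
Qed.

(** A nonzero [w] has a nonzero coordinate; comparing that coordinate on both
    sides of each eigenvector equation identifies the eigenvalues. *)
Lemma joint_eigenvector (w : Bquot lam mu gamma) (a b : F) : w != 0 ->
  qgha_h q f g *: w = a%:A *: w ->
  (qgha_x q f g * qgha_y q f g) *: w = b%:A *: w ->
  exists k, lam k = a /\ mu k = b.
Proof.
have [v -> v0] := quot_pi_surj w => hw xyw.
have [k vk] : exists k, Bcoef k v != 0.
  apply: contra_notP (elimN eqP v0) => /forallNP allk.
  rewrite Bcoef_expand; apply: big1 => k _.
  by have /negP := allk k%:Z; rewrite negbK => /eqP ->; rewrite scale0r scale0r.
have eig (u : qgha q f g) s c :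
    (forall i, u *: Btpow mu i = (s i)%:A *: Btpow mu i) ->
    (forall i, s (i + N%:Z) = s i) -> u *: pi v = c%:A *: pi v -> s k = c.
  move=> us sN uv; have /(Bcoef_ideal k)/eqP : u *: v - c%:A *: v \in B_ideal mu gamma.
    by apply/quot_piP; rewrite !linearZ.
  rewrite BcoefB BcoefC (Bcoef_diag us sN) -mulrBl mulf_eq0 (negPf vk) orbF.
  by rewrite subr_eq0 => /eqP.
exists k; split.
  exact: eig B_hC (lam_Bper mu) hw.
exact: eig B_xyC (mu_Bper mu) xyw.
Qed.

Lemma Bquot_yN (w : Bquot lam mu gamma) :
  qgha_y q f g ^+ N *: w = (gamma^-1)%:A *: w.
Proof.
have [v ->] := quot_pi_surj w; elim/Bmod_ind: v => [u v IHu IHv|c i].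
  by rewrite quot_piD [LHS]scalerDr [RHS]scalerDr IHu IHv.
rewrite linearZ /= [LHS]scaleAC [RHS]scaleAC; congr (_ *: _).
by rewrite -linearZ /= B_yn -mulN1r Btpow_modNM exprN1.
Qed.

End Quotient.

(** * Multiplication by a power of t *)

Section ShiftMap.
Variables (F : fieldType) (q : F) (f g : {poly F}) (lam lam' : Sf f).
Variables (mu : Tqg q g lam) (mu' : Tqg q g lam') (gamma : F) (m : int).
Hypotheses (q_neq0 : q != 0) (lamm : forall k, lam' k = lam (k + m)).
Hypothesis mum : forall k, mu' k = mu (k + m).

Definition Bshift (v : Bmod lam mu) : Bmod lam' mu' :=
  tpow F (- m) * (v : laurent F).

Lemma BshiftD : {morph Bshift : u v / u + v}.
Proof. by move=> u v; apply: mulrDr. Qed.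

Lemma BshiftC (c : F) v : Bshift (c%:A *: v) = c%:A *: Bshift v.
Proof. by rewrite !B_scaleC /Bshift scalerAr. Qed.

Lemma Bshift_tpow i : Bshift (Btpow mu i) = Btpow mu' (i - m).
Proof. by rewrite [i - m]addrC [RHS]tpowD. Qed.

Lemma Bshift_linear : linear Bshift.
Proof.
have ext (a : qgha q f g) :
    (forall i, Bshift (a *: Btpow mu i) = a *: Bshift (Btpow mu i)) ->
    forall v, Bshift (a *: v) = a *: Bshift v.
  move=> ai; elim/Bmod_ind => [u v IHu IHv|c i].
    by rewrite BshiftD !scalerDr BshiftD IHu IHv.
  by rewrite scaleAC !BshiftC ai scaleAC.
apply: qgha_linear; [exact: BshiftD | exact: BshiftC | | |]; apply: ext => i.
- by rewrite B_xC BshiftC !Bshift_tpow B_xC mum [i + 1 - m]addrAC [i - m + 1 + m]addrAC subrK.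
- by rewrite B_yE !Bshift_tpow B_yE addrAC.
- by rewrite B_hC BshiftC !Bshift_tpow B_hC lamm subrK.
Qed.

HB.instance Definition _ :=
  GRing.isLinear.Build (qgha q f g) _ _ *:%R Bshift Bshift_linear.

Lemma Bshift_ideal v : v \in B_ideal mu gamma -> Bshift v \in B_ideal mu' gamma.
Proof.
move=> /asboolP[r ->]; apply/asboolP; exists (tpow F (- m) * r).
by rewrite -/(Bper mu') (Bper_shift q_neq0 lamm mum) /Bshift mulrA.
Qed.

Lemma Bquot_shift :
  exists phi : {linear Bquot lam mu gamma -> Bquot lam' mu' gamma},
  forall v, phi (quot_pi (B_ideal mu gamma) v) =
            quot_pi (B_ideal mu' gamma) (Bshift v).
Proof. exact: (quot_lift_exists Bshift_ideal). Qed.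

End ShiftMap.

(** * Isomorphism classes *)

Theorem proposition3p23 (F : closedFieldType) (q : F) (q_neq0 : q != 0)
    (f g : {poly F}) (lam lam' : Sf f) (mu : Tqg q g lam) (mu' : Tqg q g lam')
    (gamma gamma' : F) (gamma_neq0 : gamma != 0) (gamma'_neq0 : gamma' != 0)
    (lam_per : (1 <= Sf_per lam)%N) (lam'_per : (1 <= Sf_per lam')%N)
    (mu_per : (1 <= Tqg_per mu)%N) (mu'_per : (1 <= Tqg_per mu')%N) :
  (exists phi : {linear Bquot lam mu gamma -> Bquot lam' mu' gamma'},
      bijective phi)
  <->
  gamma = gamma' /\
  exists i j : nat,
    [/\ (i < Sf_per lam)%N, (j < Tqg_per mu)%N,
        forall k : int, lam' k = lam (k + i%:Z)
      & forall k : int, mu' k = mu (k + i%:Z + j%:Z * (Sf_per lam)%:Z)].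
Proof.
have N_gt0 : (0 < Bper mu)%N by rewrite muln_gt0 lam_per.
have N'_gt0 : (0 < Bper mu')%N by rewrite muln_gt0 lam'_per.
split=> [[phi phi_bij]|[<- [i [j [_ _ lamE muE]]]]].
  pose e0 : Bquot lam mu gamma := quot_pi (B_ideal mu gamma) (Btpow mu 0).
  have w0 : phi e0 != 0.
    rewrite -(linear0 phi) (inj_eq (bij_inj phi_bij)); exact: Btpow_class_neq0.
  have [k [lamk muk]] : exists k, lam' k = lam 0 /\ mu' k = mu 0.
    apply: (joint_eigenvector gamma'_neq0 N'_gt0 w0).
      exact/linear_scale_eq/linear_scale_eq/B_hC.
    exact/linear_scale_eq/linear_scale_eq/B_xyC.
  have [lamS muS] := shift_of_agree q_neq0 N_gt0 N'_gt0 lamk muk.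
  have {}lamS n : lam' n = lam (n - k) by rewrite -lamS subrK.
  have {}muS n : mu' n = mu (n - k) by rewrite -muS subrK.
  split.
    have N_eq := Bper_shift q_neq0 lamS muS.
    have yw := Bquot_yN gamma'_neq0 (phi e0).
    rewrite N_eq (linear_scale_eq phi (Bquot_yN gamma_neq0 e0)) in yw.
    exact/invr_inj/(scaleA_inj w0).
  (* The shift [- k] only matters modulo the joint period: reduce it first
     modulo [|lam|], then reduce the quotient modulo [|mu|]. *)
  pose p := (Sf_per lam)%:Z; pose s := (Tqg_per mu)%:Z.
  have p0 : p != 0 by rewrite eqz_nat -lt0n.
  have s0 : s != 0 by rewrite eqz_nat -lt0n.
  have [i iE] : exists i : nat, (- k %% p)%Z = i%:Z.
    by have := modz_ge0 (- k) p0; case: (_ %% _)%Z => // i _; exists i.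
  have [j jE] : exists j : nat, ((- k %/ p)%Z %% s)%Z = j%:Z.
    by have := modz_ge0 (- k %/ p)%Z s0; case: (_ %% _)%Z => // j _; exists j.
  have kE : - k = i%:Z + j%:Z * p + ((- k %/ p)%Z %/ s)%Z * (Bper mu)%:Z.
    rewrite {1}(divz_eq (- k) p) iE {1}(divz_eq (- k %/ p)%Z s) jE.
    by rewrite /Bper mulnC PoszM mulrDl mulrA addrC addrA addrAC.
  exists i, j; split.
  - by rewrite -ltz_nat -iE ltz_pmod.
  - by rewrite -ltz_nat -jE ltz_pmod.
  - move=> n; rewrite lamS kE !addrA /Bper mulnC PoszM mulrA.
    by rewrite !lam_mulper.
  - move=> n; rewrite muS kE !addrA; set l := (_ %/ s)%Z.
    by have /(Bper_dvdP mu _ q_neq0)[_ ->] := dvdz_mull l (dvdzz (Bper mu)%:Z).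
pose m := i%:Z + j%:Z * (Sf_per lam)%:Z.
have lamm n : lam' n = lam (n + m) by rewrite addrA lam_mulper lamE.
have mum n : mu' n = mu (n + m) by rewrite addrA muE.
have lamm' n : lam n = lam' (n + - m) by rewrite lamm subrK.
have mum' n : mu n = mu' (n + - m) by rewrite mum subrK.
have [phi phiE] := Bquot_shift gamma q_neq0 lamm mum.
have [psi psiE] := Bquot_shift gamma q_neq0 lamm' mum'.
exists phi; exists psi => w; have [v ->] := quot_pi_surj w.
  rewrite phiE psiE; congr (quot_pi _ _).
  by rewrite /Bshift mulrA -tpowD opprK subrr mul1r.
rewrite psiE phiE; congr (quot_pi _ _).
by rewrite /Bshift mulrA -tpowD opprK addNr mul1r.
Qed.
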